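(* Let $V$ be a $3$-dimensional vector space over $\mathbb{F}_4=\{0,1,\omega,\bar\omega\}$ with a non-degenerate hermitian form $h$, let $s(x,y)=h(x,y)+h(y,x)$, and let $V_1=\{x\in V\mid h(x,x)=1\}$ (a set of $36$ vectors). Let $H_0$ be a hyperoval of $\mathrm{PG}(V)$ all of whose points are non-isotropic, let $\tilde H_0$ be the set of the remaining $6$ non-isotropic points, and let $W=\{x\in V_1\mid [x]\in H_0\}$ and $\tilde W=\{x\in V_1\mid [x]\in \tilde H_0\}$. Let $\Gamma$ be the graph with vertex-set $V_1$ in which two distinct vertices $u,v$ are adjacent if and only if $s(u,v)=0$, and let $\Gamma'$ be the graph obtained by switching $\Gamma$ with respect to $W$. Then the complementary graph $\overline{\Gamma'}$ is a strongly regular graph with parameters $(36,14,4,6)$, and its edges are exactly the pairs of the following three types: (i) $\{u,v\}$ where $u,v\in W$ and $h(u,v)=\omega$ or $\bar\omega$; (ii) $\{u,v\}$ where $u,v\in\tilde W$ and $h(u,v)=\omega$ or $\bar\omega$; (iii) $\{u,v\}$ where $u\in W$, $v\in\tilde W$ and $h(u,v)=1$.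
   Context: Here $\bar a=a^2$ for $a\in\mathbb{F}_4$. A hermitian form $h$ on $V$ is linear in one variable and semilinear (with respect to $a\mapsto\bar a$) in the other, with $h(y,x)=\overline{h(x,y)}$. $\mathrm{PG}(V)$ is the projective plane of order $4$ whose points are the $1$-dimensional subspaces $[x]$ of $V$ ($x\neq 0$); the point $[x]$ is non-isotropic if $h(x,x)\neq 0$ (then $h(x,x)=1$). There are $12$ non-isotropic points. A hyperoval is a set of $6$ points, no three collinear. $V_1$ is the disjoint union of $W$ and $\tilde W$, each consisting of $18$ vectors. Graphs are finite, simple and undirected; the complement of a graph has the same vertices, two distinct vertices being adjacent in the complement if and only if they are not adjacent in the graph. Switching a graph with respect to a subset $Y$ of its vertices means interchanging edges and non-edges between $Y$ and its complement, leaving adjacency inside $Y$ and inside the complement unchanged. A strongly regular graph with parameters $(n,k,\lambda,\mu)$ is a $k$-regular graph on $n$ vertices, neither complete nor null, such that any two adjacent vertices have exactly $\lambda$ common neighbours and any two distinct non-adjacent vertices have exactly $\mu$ common neighbours. *)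

(* Defs.v *)
From HB Require Import structures.
From mathcomp Require Import all_boot all_algebra all_field.
From mathcomp Require Export sesquilinear.

Set Implicit Arguments.
Unset Strict Implicit.
Unset Printing Implicit Defensive.

Import GRing.Theory.
Local Open Scope ring_scope.

Record sgraph (T : finType) := SGraph {
  adj :> rel T;
  adj_sym : symmetric adj;
  adj_irr : irreflexive adj }.

Section Graphs.
Variable T : finType.
Implicit Types (G : sgraph T) (Y : {set T}).

Definition edges G : {set {set T}} := [set [set u; v] | u in T, v in T & G u v].

Definition compl_adj G : rel T := [rel u v | (u != v) && ~~ G u v].

Fact compl_adj_sym G : symmetric (compl_adj G).
Proof. by move=> u v; rewrite /compl_adj /= eq_sym adj_sym. Qed.

Fact compl_adj_irr G : irreflexive (compl_adj G).
Proof. by move=> u; rewrite /compl_adj /= eqxx. Qed.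

Definition compl_graph G := SGraph (compl_adj_sym G) (compl_adj_irr G).

Definition switch_adj G Y : rel T :=
  [rel u v | if (u \in Y) == (v \in Y) then G u v else ~~ G u v].

Fact switch_adj_sym G Y : symmetric (switch_adj G Y).
Proof. by move=> u v; rewrite /switch_adj /= eq_sym adj_sym. Qed.

Fact switch_adj_irr G Y : irreflexive (switch_adj G Y).
Proof. by move=> u; rewrite /switch_adj /= eqxx adj_irr. Qed.

Definition switch_graph G Y := SGraph (switch_adj_sym G Y) (switch_adj_irr G Y).

Definition is_complete G := forall u v, u != v -> G u v.
Definition is_null G := forall u v, ~~ G u v.
Definition is_regular G (k : nat) := forall u, #|[set v | G u v]| = k.
Definition common_neighbours G u v := [set x | G u x && G v x].

Definition strongly_regular G (n k lambda mu : nat) : Prop :=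
  [/\ #|T| = n /\ is_regular G k,
      ~ is_complete G,
      ~ is_null G,
      forall u v, G u v -> #|common_neighbours G u v| = lambda
    & forall u v, u != v -> ~~ G u v -> #|common_neighbours G u v| = mu].

End Graphs.

(* Conjugation of the field of order 4.  The (otherwise unused) proof that
   #|F| = 4 is an argument because squaring is additive only in characteristic 2
   and involutive only on the field of order at most 4. *)

Definition conj4 (F : finFieldType) (oF : #|F| = 4%N) (a : F) : F := a ^+ 2.

Section Conj4.
Variables (F : finFieldType) (oF : #|F| = 4%N).

Fact pchar_F4 : 2 \in [pchar F].
Proof. exact: (@card_finPcharP F 2 2). Qed.

Fact conj4_zmod_morphism : zmod_morphism (conj4 oF).
Proof. by move=> a b; rewrite /conj4 -!(pFrobenius_autE pchar_F4) rmorphB. Qed.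

Fact conj4_monoid_morphism : monoid_morphism (conj4 oF).
Proof. by split=> [|a b]; rewrite /conj4 ?expr1n ?exprMn. Qed.

Fact conj4K : involutive (conj4 oF).
Proof. by move=> a; rewrite /conj4 -exprM -[(2 * 2)%N]oF expf_card. Qed.

HB.instance Definition _ :=
  GRing.isZmodMorphism.Build F F (conj4 oF) conj4_zmod_morphism.
HB.instance Definition _ :=
  GRing.isMonoidMorphism.Build F F (conj4 oF) conj4_monoid_morphism.
HB.instance Definition _ := isInvolutive.Build F (conj4 oF) conj4K.

End Conj4.

Section FinSubspaces.
Import VectorInternalTheory.
Variables (F : finFieldType) (V : vectType F).

HB.instance Definition _ := [Countable of {vspace V} by <:].
HB.instance Definition _ := [Finite of {vspace V} by <:].

End FinSubspaces.

Section ProjectiveGeometry.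
Variables (F : finFieldType) (V : vectType F).
Implicit Types (P Q R L : {vspace V}) (H : {set {vspace V}}).

Definition pg_points : {set {vspace V}} := [set P | \dim P == 1%N].
Definition pg_lines : {set {vspace V}} := [set L | \dim L == 2%N].

Definition collinear P Q R :=
  [exists L in pg_lines, [&& (P <= L)%VS, (Q <= L)%VS & (R <= L)%VS]].

Definition hyperoval H : Prop :=
  [/\ H \subset pg_points, #|H| = 6%N
    & {in H & H & H, forall P Q R,
        P != Q -> P != R -> Q != R -> ~~ collinear P Q R}].

End ProjectiveGeometry.

Section Hermitian.
Variables (F : finFieldType) (oF : #|F| = 4%N) (V : vectType F).
Variable h : {hermitian V for false & conj4 oF}.

Definition sform (x y : V) : F := h x y + h y x.

(* [finvect_type V] is [V] itself, with its finite type structure. *)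
Definition nonisotropic : {set {vspace V}} :=
  [set <[x : V]>%VS | x : finvect_type V & (x != 0) && (h x x != 0)].

Definition V1 : finType := {x : finvect_type V | h x x == 1}.

Definition hV1 (u v : V1) : F := h (val u) (val v).

Definition vectors_over (H : {set {vspace V}}) : {set V1} :=
  [set x : V1 | <[val x : V]>%VS \in H].

Definition Gamma_adj : rel V1 :=
  [rel u v | (u != v) && (sform (val u) (val v) == 0)].

Fact Gamma_adj_sym : symmetric Gamma_adj.
Proof. by move=> u v; rewrite /Gamma_adj /= eq_sym /sform addrC. Qed.

Fact Gamma_adj_irr : irreflexive Gamma_adj.
Proof. by move=> u; rewrite /Gamma_adj /= eqxx. Qed.

Definition Gamma : sgraph V1 := SGraph Gamma_adj_sym Gamma_adj_irr.

End Hermitian.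

(* Main.v *)
Require Import Defs.
From HB Require Import structures.
From mathcomp Require Import all_boot all_algebra all_field ring.

Set Implicit Arguments.
Unset Strict Implicit.
Unset Printing Implicit Defensive.

Import GRing.Theory.
Local Open Scope ring_scope.

(** Everything is reduced to a single explicit graph by choosing coordinates
    adapted to the hyperoval.

    The key geometric fact is that the hyperoval is closed under orthogonality
    of unit vectors ([hyperoval_orthogonal]).  A line through a point of a
    hyperoval in a plane of order 4 carries exactly one further point of it,
    since there are 5 such lines and 5 further points.  If [x], [y], [z] is an
    orthonormal frame and $\langle x\rangle$ lies on the hyperoval, the only
    non-isotropic points of the line $\langle x, y\rangle$ are
    $\langle x\rangle$ and $\langle y\rangle$, so $\langle y\rangle$ has to
    be that further point.  The same fact shows that $h(u,v) \neq 0$ whenever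
    $u \in W$ and $v \in \tilde W$.  Since $s(u,v)$ is the trace of $h(u,v)$
    from $F_4$ to $F_2$, and the trace vanishes exactly at 0 and 1, the
    description of the edges follows ([edges_compl_switch_Gamma]).

    The hyperoval has 6 points and so contains a frame together with a point
    having three non-zero coordinates in it; rescaling the frame makes this
    point $\langle x + y + z\rangle$ ([adapted_frame_exists]).  The hyperoval
    is then determined: a unit vector $(a,b,c)$ spans a point of it if and only
    if $abc$ is in $F_2$ ([mem_hyperoval]).  Writing $p(u)$ for the product of
    the coordinates of $u$, two vectors [u] and [v] are adjacent in the
    complement of the switched graph if and only if
    $Tr (p(u) + p(v) + h(u,v)) = 1$.  This depends on coordinates alone, so the
    graph is isomorphic to a concrete one on the 36 unit vectors of $F_4^3$
    with the standard hermitian form, whose parameters are found by counting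
    ([model_srg]). *)

(** * The field of order 4 *)

Section FieldOfOrder4.
Variables (F : finFieldType) (oF : #|F| = 4%N).
Implicit Types a b : F.

Lemma norm4 a : a != 0 -> a * conj4 oF a = 1.
Proof.
move=> a0; apply: (mulfI a0).
by rewrite /conj4 -!exprS -[in LHS]oF expf_card mulr1.
Qed.

Lemma norm4_mem a : a * conj4 oF a = (a != 0)%:R.
Proof. by have [->|/norm4] := eqVneq a 0; rewrite ?mul0r. Qed.

Lemma oppr4 a : - a = a.
Proof. exact: oppr_pchar2 (pchar_F4 oF) a. Qed.

Lemma addrr4 a : a + a = 0.
Proof. exact: addrr_pchar2 (pchar_F4 oF) a. Qed.

Lemma conj4_eq0 a : (conj4 oF a == 0) = (a == 0).
Proof. by rewrite /conj4 expf_eq0. Qed.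

Lemma conj4_fix a : (conj4 oF a == a) = (a == 0) || (a == 1).
Proof.
rewrite -subr_eq0 /conj4 expr2 -{3}[a]mulr1 -mulrBr mulf_eq0.
by rewrite subr_eq0.
Qed.

(** Such an element is a root of $(X^3 - 1)/(X - 1)$. *)
Lemma sum3_root1 a : a != 1 -> a != 0 -> 1 + a + conj4 oF a = 0.
Proof.
move=> a1 a0; have n1 : a - 1 != 0 by rewrite subr_eq0.
apply: (mulfI n1); rewrite mulr0.
transitivity (a ^+ 3 - 1); last by rewrite exprS norm4 ?subrr.
by rewrite (subrX1 a 3) !big_ord_recr big_ord0 /= add0r expr0 expr1.
Qed.

End FieldOfOrder4.

(** * Unit vectors and orthonormal frames *)

Section Frames.
Variables (F : finFieldType) (oF : #|F| = 4%N) (V : vectType F).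
Variable h : {hermitian V for false & conj4 oF}.
Implicit Types (u v x y z p q : V) (U : {vspace V}).

Lemma hC u v : h u v = conj4 oF (h v u).
Proof. by rewrite (hermC h) expr0 mul1r. Qed.

Lemma hDl u v x : h (u + v) x = h u x + h v x. Proof. exact: linearDl. Qed.
Lemma hZl a v x : h (a *: v) x = a * h v x. Proof. exact: linearZl_LR. Qed.
Lemma hDr u v x : h x (u + v) = h x u + h x v. Proof. exact: linearDr. Qed.
Lemma hZr a v x : h x (a *: v) = conj4 oF a * h x v.
Proof. exact: linearZr. Qed.
Lemma h0l x : h 0 x = 0. Proof. exact: linear0l. Qed.

Lemma hC_eq0 u v : h u v = 0 -> h v u = 0.
Proof. by move=> uv; rewrite hC uv rmorph0. Qed.

(** Diagonal values of a hermitian form are fixed by conjugation, hence lie in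
    the prime field. *)
Lemma norm_eq1 v : (h v v == 1) = (h v v != 0).
Proof.
have /eqP := hC v v; rewrite eq_sym conj4_fix => /orP[] /eqP->.
  by rewrite eqxx eq_sym oner_eq0.
by rewrite eqxx oner_eq0.
Qed.

Lemma norm_neq0 v : h v v = 1 -> v != 0.
Proof. by move=> v1; apply/eqP=> v0; move/eqP: v1; rewrite v0 h0l eq_sym oner_eq0. Qed.

(** If every vector of the orthogonal space of [U] were isotropic, then [h] would
    vanish identically on it, and that space would lie in the radical of [h]. *)
Lemma exists_unit_orthov U : nondegenerate h ->
  (U + orthov h U = fullv)%VS -> U != fullv ->
  exists2 v, v \in orthov h U & h v v = 1.
Proof.
move=> h_nd Usplit Uproper.
have [/existsP[v /andP[vU v1]] | /existsPn no_unit] :=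
  boolP [exists v : finvect_type V, (v \in orthov h U) && (h v v == 1)].
  by exists v => //; apply/eqP.
have iso v : v \in orthov h U -> h v v = 0.
  by move=> vU; have := no_unit v; rewrite vU norm_eq1 negbK => /eqP.
have alt u v : u \in orthov h U -> v \in orthov h U -> h u v = 0.
  (* the values of a sesquilinear form that vanishes on the diagonal are
     fixed by conjugation, and so are all their multiples; as conjugation is
     not the identity, such values are 0 *)
  move=> uU vU; have fix2 a : conj4 oF (a * h u v) = a * h u v.
    have /eqP := iso _ (memvD (memvZ a uU) vU).
    rewrite hDl !hDr (iso _ vU) (iso _ (memvZ a uU)) add0r addr0 hZl.
    by rewrite [h v _]hC hZl addr_eq0 oppr4 // => /eqP {2}->.
  apply/eqP; apply: contraT => huv; have [w nw] : exists w : F, conj4 oF w != w.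
    apply/existsP; apply: contraT => /existsPn triv.
    have sub : [set: F] \subset [set 0; 1].
      by apply/subsetP=> a _; rewrite !inE -(conj4_fix oF); have := triv a; rewrite negbK.
    by have := subset_leq_card sub; rewrite cardsT oF cards2; case: (_ != _).
  by have := fix2 (w / h u v); rewrite divfK // => /eqP; rewrite (negbTE nw).
have rad0 v : v \in orthov h U -> v = 0.
  move=> vU; apply/eqP; rewrite -memv0 -(eqP h_nd).
  apply/mem_orthovP=> t _.
  have: t \in (U + orthov h U)%VS by rewrite Usplit memvf.
  case/memv_addP=> a aU [b bU ->]; rewrite hDr (alt _ _ vU bU) addr0.
  by have /mem_orthovP := vU; apply.
case/eqP: Uproper; apply/vspaceP=> v; rewrite memvf.
have: v \in (U + orthov h U)%VS by rewrite Usplit memvf.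
by case/memv_addP=> a aU [b /rad0-> ->]; rewrite addr0.
Qed.

(** Together with [exists_unit_orthov] this is the inductive step in the
    construction of an orthonormal basis. *)
Lemma orthov_split_add U v : (U + orthov h U = fullv)%VS ->
  v \in orthov h U -> h v v = 1 ->
  (U + <[v]> + orthov h (U + <[v]>) = fullv)%VS.
Proof.
move=> Usplit vU v1; apply/vspaceP=> t; rewrite memvf.
have: t \in (U + orthov h U)%VS by rewrite Usplit memvf.
case/memv_addP=> a aU [b bU ->].
rewrite (_ : a + b = (a + h b v *: v) + (b - h b v *: v)); last first.
  by rewrite addrACA subrr addr0.
apply: memv_add; first by apply: memv_add => //; apply: memvZ; apply: memv_line.
apply/mem_orthovP=> _ /memv_addP[c cU [_ /vlineP[k ->] ->]].
rewrite hDr hZr -scaleNr !hDl !hZl v1 mulr1 subrr mulr0 addr0.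
have /mem_orthovP-> := bU; rewrite ?cU //.
by have /mem_orthovP-> := vU; rewrite ?mulr0 ?addr0.
Qed.

Definition frame x y z :=
  [/\ h x x = 1, h y y = 1 & h z z = 1] /\ [/\ h x y = 0, h x z = 0 & h y z = 0].

Lemma frame_scale x y z a b c : frame x y z ->
  a != 0 -> b != 0 -> c != 0 -> frame (a *: x) (b *: y) (c *: z).
Proof.
case=> -[x1 y1 z1] [xy xz yz] a0 b0 c0.
by split; split; rewrite hZl hZr ?x1 ?y1 ?z1 ?xy ?xz ?yz ?mulr0 ?mulr1 ?norm4.
Qed.

Hypothesis dimV : \dim {:V}%VS = 3%N.

Lemma frame_extend x y : nondegenerate h -> h x x = 1 -> h y y = 1 -> h x y = 0 ->
  exists z, frame x y z.
Proof.
move=> h_nd x1 y1 xy.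
have s0 : (0 + orthov h 0 = fullv :> {vspace V})%VS by rewrite orthov0 add0v.
have s1 := orthov_split_add s0 (_ : x \in _) x1.
rewrite orthov0 memvf add0v in s1.
have yx : y \in orthov h <[x]> by rewrite mem_orthov1 (hC_eq0 xy).
have s2 := orthov_split_add (s1 isT) yx y1.
have [|z zU z1] := exists_unit_orthov h_nd s2.
  apply/eqP=> /(congr1 (fun U => \dim U))/eqP; rewrite dimV eqn_leq andbC.
  by rewrite leqNgt (leq_ltn_trans (dimv_add_leqif _ _).1) // !dim_vline; do 2![case: (_ != _)].
have zo t : t \in (<[x]> + <[y]>)%VS -> h t z = 0.
  by move=> tU; apply: hC_eq0; have /mem_orthovP-> := zU.
have xU : x \in (<[x]> + <[y]>)%VS by rewrite memvE addvSl.
have yU : y \in (<[x]> + <[y]>)%VS by rewrite memvE addvSr.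
by exists z; split; split=> //; apply: zo.
Qed.

Lemma frame_exists x : nondegenerate h -> h x x = 1 -> exists y z, frame x y z.
Proof.
move=> h_nd x1.
have s0 : (0 + orthov h 0 = fullv :> {vspace V})%VS by rewrite orthov0 add0v.
have s1 := orthov_split_add s0 (_ : x \in _) x1.
rewrite orthov0 memvf add0v in s1.
have [|y yU y1] := exists_unit_orthov h_nd (s1 isT).
  by apply/eqP=> /(congr1 (fun U => \dim U))/eqP; rewrite dimV dim_vline; case: (_ != _).
have xy : h x y = 0 by apply: hC_eq0; apply/eqP; rewrite -mem_orthov1.
by have [z fr] := frame_extend h_nd x1 y1 xy; exists y, z.
Qed.

Lemma frame_expand x y z v : frame x y z ->
  v = h v x *: x + h v y *: y + h v z *: z.
Proof.
case=> -[x1 y1 z1] [xy xz yz].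
have xyz_free : free [:: x; y; z].
  rewrite !free_cons span_cons span_seq1 span_nil nil_free memv0.
  rewrite (norm_neq0 z1) !andbT; apply/andP; split; last first.
    apply/vlineP=> -[a y_az]; move/eqP: y1.
    by rewrite {1}y_az hZl (hC_eq0 yz) mulr0 eq_sym oner_eq0.
  apply/memv_addP=> -[_ /vlineP[a ->] [_ /vlineP[b ->] x_yz]].
  move/eqP: x1; rewrite {1}x_yz hDl !hZl (hC_eq0 xy) (hC_eq0 xz).
  by rewrite !mulr0 addr0 eq_sym oner_eq0.
have spanV : <<[:: x; y; z]>>%VS = fullv.
  by apply/eqP; rewrite eqEdim subvf dimV (eqP xyz_free).
have: v \in <<[:: x; y; z]>>%VS by rewrite spanV memvf.
rewrite !span_cons span_nil addv0.
case/memv_addP=> _ /vlineP[a ->] [_ /memv_addP[_ /vlineP[b ->] [_ /vlineP[c ->] ->]] ->].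
rewrite !hDl !hZl x1 y1 z1 xy xz yz (hC_eq0 xy) (hC_eq0 xz) (hC_eq0 yz).
by rewrite !mulr0 !mulr1 !addr0 !add0r addrA.
Qed.

Lemma frame_form x y z u v : frame x y z ->
  h u v = h u x * conj4 oF (h v x) + h u y * conj4 oF (h v y)
          + h u z * conj4 oF (h v z).
Proof.
move=> fr; rewrite {1}(frame_expand u fr) !hDl !hZl.
by rewrite -(hC x) -(hC y) -(hC z).
Qed.

Lemma vlineZ a v : a != 0 -> (<[a *: v]> = <[v]>)%VS.
Proof.
move=> a0; apply/eqP; rewrite eqEsubv; apply/andP; split; rewrite -memvE.
  by rewrite memvZ ?memv_line.
by apply/vlineP; exists a^-1; rewrite scalerA mulVf ?scale1r.
Qed.

(** Norms of non-zero elements are 1, so in characteristic 2 the norm of [v] is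
    the parity of the number of its non-zero coordinates; if one coordinate
    vanishes, exactly one survives. *)
Lemma frame_isolated x y z v : frame x y z -> h v v = 1 ->
  h v x * h v y * h v z = 0 -> <[v]>%VS \in [:: <[x]>%VS; <[y]>%VS; <[z]>%VS].
Proof.
move=> fr v1; have := frame_form v v fr; rewrite v1 !norm4_mem.
have := frame_expand v fr.
set a := h v x; set b := h v y; set c := h v z.
have [->|a0] := eqVneq a 0; have [->|b0] := eqVneq b 0;
have [->|c0] := eqVneq c 0 => //= ve;
 rewrite ?(addr0, add0r, addrr4 oF) //;
 try (move/eqP; rewrite oner_eq0 //);
 try (move=> _ /eqP; rewrite !mulf_eq0 (negbTE a0) (negbTE b0) (negbTE c0) //);
 move=> _ _; rewrite ve !scale0r ?addr0 ?add0r vlineZ // !inE eqxx ?orbT //.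
Qed.

(** * Hyperovals of non-isotropic points *)

Hypothesis h_nondeg : nondegenerate h.
Variable H : {set {vspace V}}.
Hypotheses (H_hyperoval : hyperoval H) (H_nonisotropic : H \subset nonisotropic h).

Lemma norm_vline u v : <[u]>%VS = <[v]>%VS -> u != 0 -> h v v = 1 -> h u u = 1.
Proof.
move=> uv u0 v1; have: u \in <[v]>%VS by rewrite -uv memv_line.
case/vlineP=> a ua; move: u0; rewrite ua scaler_eq0 negb_or => /andP[a0 _].
by rewrite hZl hZr v1 mulr1 norm4.
Qed.

Lemma hyperoval_pick P : P \in H -> P = <[vpick P]>%VS /\ h (vpick P) (vpick P) = 1.
Proof.
move/(subsetP H_nonisotropic)=> /imsetP[x]; rewrite inE => /andP[x0 x1] ->.
set Q := (X in vpick X); have Q0 : vpick Q != 0 by rewrite vpick0 -dimv_eq0 dim_vline x0.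
have QE : Q = <[vpick Q]>%VS.
  apply/esym/eqP; rewrite eqEdim !dim_vline x0 Q0 andbT -memvE; exact: memv_pick.
split; first exact: QE.
apply: (norm_vline (esym QE) Q0); apply/eqP; by rewrite norm_eq1.
Qed.

Lemma hyperoval_unit P : P \in H -> exists2 p, h p p = 1 & P = <[p]>%VS.
Proof. by case/hyperoval_pick=> PE P1; exists (vpick P). Qed.

Lemma mem_nonisotropic u : h u u = 1 -> <[u]>%VS \in nonisotropic h.
Proof.
move=> u1; apply/imsetP; exists u => //.
by rewrite inE (norm_neq0 u1) u1 oner_eq0.
Qed.

Lemma hyperoval_chord u v t a b : <[u]>%VS \in H -> <[v]>%VS \in H ->
  <[t]>%VS \in H -> t = a *: u + b *: v -> <[u]>%VS != <[v]>%VS ->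
  <[t]>%VS = <[u]>%VS \/ <[t]>%VS = <[v]>%VS.
Proof.
have [sHP _ no3] := H_hyperoval; move=> uH vH tH tE uv.
have [->|tu] := eqVneq <[t]>%VS <[u]>%VS; first by left.
have [->|tv] := eqVneq <[t]>%VS <[v]>%VS; first by right.
have /negP[] : ~~ collinear <[u]>%VS <[v]>%VS <[t]>%VS.
  by apply: no3; rewrite // eq_sym.
apply/existsP; exists (<[u]> + <[v]>)%VS.
rewrite addvSl addvSr -memvE tE memv_add ?memvZ ?memv_line // !andbT inE.
have := subsetP sHP _ uH; have := subsetP sHP _ vH; rewrite !inE => /eqP dv /eqP du.
rewrite dimv_disjoint_sum ?du ?dv //; apply/eqP; rewrite -dimv_eq0 -leqn0 leqNgt.
apply: contra uv => cap_gt0; have capu := capvSl <[u]>%VS <[v]>%VS.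
have/eqP capuE : (<[u]> :&: <[v]>)%VS == <[u]>%VS by rewrite eqEdim capu du.
have/eqP capvE : (<[u]> :&: <[v]>)%VS == <[v]>%VS by rewrite eqEdim capvSr dv.
by rewrite -capuE capvE.
Qed.

(** The lines through $\langle x\rangle$ are told apart by the ratio of the [y]- and
    [z]-coordinates of their points.  If $\langle y\rangle$ were not on the
    hyperoval, no other point of the hyperoval would have [z]-coordinate 0, and
    this ratio would map its 5 points off $\langle x\rangle$ injectively into
    a field with 4 elements. *)
Lemma hyperoval_frame x y z : frame x y z -> <[x]>%VS \in H -> <[y]>%VS \in H.
Proof.
move=> fr xH; have [[x1 y1 z1] [xy xz yz]] := fr.
have [sHP cardH _] := H_hyperoval.
apply: contraT => yH.
pose m P := h (vpick P) y / h (vpick P) z.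
have nz P : P \in H :\ <[x]>%VS -> h (vpick P) z != 0.
  rewrite in_setD1 => /andP[Px PH]; have [PE P1] := hyperoval_pick PH.
  apply/eqP=> pz; have := frame_isolated fr P1; rewrite pz mulr0 => /(_ erefl).
  rewrite -PE !inE (negbTE Px) /= => /orP[] /eqP Pe.
    by case/negP: yH; rewrite -Pe.
  move/eqP: z1; rewrite (_ : h z z = 0) 1?eq_sym ?oner_eq0 //.
  have: z \in P by rewrite Pe memv_line.
  by rewrite PE => /vlineP[a {1}->]; rewrite hZl pz mulr0.
have m_inj : {in H :\ <[x]>%VS &, injective m}.
  move=> P Q PHx QHx mPQ; have Pz := nz P PHx; have Qz := nz Q QHx.
  move: PHx QHx; rewrite !in_setD1 => /andP[Px PH] /andP[Qx QH].
  have [PE P1] := hyperoval_pick PH; have [QE Q1] := hyperoval_pick QH.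
  pose r := h (vpick Q) z / h (vpick P) z.
  have Qz_eq : h (vpick Q) z = r * h (vpick P) z by rewrite divfK.
  have Qy : h (vpick Q) y = r * h (vpick P) y.
    by rewrite /r mulrAC -mulrA -[_ / _]/(m P) mPQ /m mulrC divfK.
  have QE2 : vpick Q = r *: vpick P + (h (vpick Q) x - r * h (vpick P) x) *: x.
    rewrite {1}(frame_expand (vpick Q) fr) {1}(frame_expand (vpick P) fr).
    rewrite !scalerDr !scalerA -Qy -Qz_eq scalerBl [RHS]addrC !addrA.
    by rewrite subrK.
  have := hyperoval_chord _ xH _ QE2; rewrite -PE -QE => /(_ PH QH Px) [->//|].
  by move/eqP; rewrite (negbTE Qx).
have := max_card [in m @: (H :\ <[x]>%VS)]; rewrite (card_in_imset m_inj) oF.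
by have := cardsD1 <[x]>%VS H; rewrite cardH xH add1n => -[<-].
Qed.

Lemma hyperoval_orthogonal x y : h x x = 1 -> h y y = 1 -> h x y = 0 ->
  <[x]>%VS \in H -> <[y]>%VS \in H.
Proof.
move=> x1 y1 xy; have [z fr] := frame_extend h_nondeg x1 y1 xy.
exact: hyperoval_frame fr.
Qed.

Lemma exists_other_mem (T : finType) (A : {set T}) (a b c : T) :
  (3 < #|A|)%N -> exists2 d, d \in A & d \notin [:: a; b; c].
Proof.
move=> A_gt3; have : ~~ (A \subset [:: a; b; c]).
  apply: contraL A_gt3 => /subset_leq_card A_le; rewrite -leqNgt.
  exact: leq_trans A_le (card_size [:: a; b; c]).
by case/subsetPn=> d; exists d.
Qed.

(** The hyperoval contains a whole frame by [hyperoval_orthogonal], and some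
    further point as it has more than three points; absorbing the coordinates
    of that point into the frame turns it into the sum of the frame vectors. *)
Lemma adapted_frame_exists : exists x y z,
  frame x y z /\ [/\ <[x]>%VS \in H, <[y]>%VS \in H, <[z]>%VS \in H
                   & <[x + y + z]>%VS \in H].
Proof.
have [_ cardH _] := H_hyperoval.
have /card_gt0P[P PH] : (0 < #|H|)%N by rewrite cardH.
have [x x1 PE] := hyperoval_unit PH; rewrite PE in PH => {P PE}.
rename PH into xH.
have [y [z fr]] := frame_exists h_nondeg x1.
have [[_ y1 z1] [xy xz yz]] := fr.
have yH := hyperoval_orthogonal x1 y1 xy xH.
have zH := hyperoval_orthogonal x1 z1 xz xH.
have [|Q QH Q_out] := @exists_other_mem _ H <[x]>%VS <[y]>%VS <[z]>%VS.
  by rewrite cardH.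
have [v v1 QE] := hyperoval_unit QH; rewrite {Q}QE in QH Q_out.
have : h v x * h v y * h v z != 0.
  by apply/eqP=> /(frame_isolated fr v1) v_in; rewrite v_in in Q_out.
rewrite !mulf_eq0 !negb_or -andbA => /and3P[a0 b0 c0].
exists (h v x *: x), (h v y *: y), (h v z *: z).
by split; [exact: frame_scale | rewrite !vlineZ // -frame_expand].
Qed.

Definition coord_prod x y z v := h v x * h v y * h v z.

(** When the product of the coordinates is 0, the point is one of the frame
    points.  When it is 1, [v] is either proportional or orthogonal to
    $x + y + z$, because $1 + t + t^2 = 0$ for $t \neq 0, 1$.  In the
    remaining case, changing the [z]-coordinate to make the product 1 gives a
    point of the hyperoval collinear with $\langle v\rangle$ and
    $\langle z\rangle$, which excludes $\langle v\rangle$. *)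
Lemma mem_hyperoval x y z v : frame x y z ->
    [/\ <[x]>%VS \in H, <[y]>%VS \in H, <[z]>%VS \in H & <[x + y + z]>%VS \in H] ->
    h v v = 1 ->
  (<[v]>%VS \in H) = (conj4 oF (coord_prod x y z v) == coord_prod x y z v).
Proof.
move=> fr [xH yH zH fH] v1; rewrite conj4_fix /coord_prod.
have [[x1 y1 z1] [xy xz yz]] := fr.
have [p0|] := eqVneq (h v x * h v y * h v z) 0.
  by have := frame_isolated fr v1 p0; rewrite !inE => /or3P[] /eqP ->.
have := frame_expand v fr.
pose a : F := h v x; pose b : F := h v y; pose c : F := h v z.
rewrite -/a -/b -/c => vE; move: a b c vE => a b c vE.
rewrite !mulf_eq0 !negb_or -andbA => /and3P[a0 b0 c0] /=.
(* g is the vector of coordinate product 1 on the line joining v to z *)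
pose g := a *: x + b *: y + (a * b)^-1 *: z.
have ab0 : a * b != 0 by rewrite mulf_neq0.
have fr' := frame_scale fr a0 b0 (invr_neq0 ab0).
have f1 : h (x + y + z) (x + y + z) = 1.
  rewrite !hDl !hDr x1 y1 z1 xy xz yz (hC_eq0 xy) (hC_eq0 xz) (hC_eq0 yz).
  by rewrite !addr0 !add0r addrr4 // add0r.
have g1 : h g g = 1.
  have [[gx1 gy1 gz1] [gxy gxz gyz]] := fr'.
  rewrite !hDl !hDr gx1 gy1 gz1 gxy gxz gyz (hC_eq0 gxy) (hC_eq0 gxz) (hC_eq0 gyz).
  by rewrite !addr0 !add0r addrr4 // add0r.
have gH : <[g]>%VS \in H.
  have cE : (a * b)^-1 = a * conj4 oF (b / a).
    apply: (mulfI ab0); rewrite mulfV // rmorphM fmorphV /=.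
    rewrite mulrACA (mulrA b) norm4 // mul1r -expr2 -[a ^+ 2]/(conj4 oF a).
    by apply/esym/mulfV; rewrite conj4_eq0.
  have gE : g = a *: (x + (b / a) *: y + conj4 oF (b / a) *: z).
    by rewrite /g cE !scalerDr !scalerA [a * (b / a)]mulrC divfK.
  rewrite gE vlineZ //.
  have [->|t1] := eqVneq (b / a) 1; first by rewrite rmorph1 !scale1r.
  apply: hyperoval_orthogonal fH => //.
    have := g1; rewrite gE hZl hZr mulrA norm4 // mul1r; exact.
  rewrite !hDl !hDr !hZr x1 y1 z1 xy xz yz (hC_eq0 xy) (hC_eq0 xz) (hC_eq0 yz).
  rewrite !mulr0 !mulr1 !addr0 !add0r conj4K addrAC sum3_root1 //.
  by rewrite mulf_neq0 ?invr_neq0.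
have [abc1|abc1] := eqVneq (a * b * c) 1.
  by rewrite vE (_ : c = (a * b)^-1) //; apply: (mulfI ab0); rewrite abc1 mulfV.
apply/negP=> vH; have vg : v = 1 *: g + (c - (a * b)^-1) *: z.
  by rewrite scale1r vE /g -[RHS]addrA -scalerDl [_^-1 + _]addrC subrK.
have zx := hC_eq0 xz; have yx := hC_eq0 xy.
have gx : h g x = a by rewrite /g !hDl !hZl x1 yx zx !mulr0 !addr0 mulr1.
have vx : h v x = a by rewrite vE !hDl !hZl x1 yx zx !mulr0 !addr0 mulr1.
have not_z u : h u x = a -> <[u]>%VS != <[z]>%VS.
  move=> ux; apply: contra a0 => /eqP uz; rewrite -ux.
  have: u \in <[z]>%VS by rewrite -uz memv_line.
  by case/vlineP=> k ->; rewrite hZl zx mulr0.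
have [vg_eq|vz] := hyperoval_chord gH zH vH vg (not_z g gx); last first.
  by have := not_z v vx; rewrite vz eqxx.
have: v \in <[g]>%VS by rewrite -vg_eq memv_line.
case/vlineP=> k vk; have k1 : k = 1.
  by apply: (mulIf a0); rewrite -{1}gx -hZl -vk vx mul1r.
move/eqP: abc1; apply; have := congr1 (h^~ z) vk.
rewrite k1 scale1r vE /g !hDl !hZl xz yz z1 !mulr0 !mulr1 !add0r => ->.
by rewrite mulfV.
Qed.

End Frames.

(** * Complements of switched graphs, and transfer to a model *)

Lemma compl_switchE (T : finType) (G : sgraph T) (Y : {set T}) u v :
  compl_graph (switch_graph G Y) u v =
  (u != v) && (((u \in Y) == (v \in Y)) (+) G u v).
Proof. by rewrite /= /compl_adj /= /switch_adj /=; case: (_ == (v \in Y)); rewrite ?negbK. Qed.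

Section GraphTransfer.
Variables (T : finType) (S : eqType) (f : T -> S) (vertices : seq S).
Hypothesis f_inj : injective f.
Hypothesis f_enum : perm_eq (map f (enum T)) vertices.

Lemma card_preim_count (p : pred S) : #|[set v | p (f v)]| = count p vertices.
Proof.
by rewrite -(permP f_enum) count_map enumT cardsE cardE /enum_mem size_filter.
Qed.

(** The bounds on [k] exclude the null graph and the complete graph. *)
Lemma strongly_regular_model (G : sgraph T) (e : rel S) (k lambda mu : nat) :
    (forall u v, G u v = e (f u) (f v)) ->
    (0 < k)%N -> (k.+1 < size vertices)%N ->
    all (fun s => (count (e s) vertices == k) && all (fun t => (s == t) ||
      (count (fun r => e s r && e t r) vertices == if e s t then lambda else mu))
      vertices) vertices ->
  strongly_regular G (size vertices) k lambda mu.
Proof.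
move=> Ge k_gt0 k_lt /allP e_srg.
have f_mem u : f u \in vertices by rewrite -(perm_mem f_enum) map_f ?mem_enum.
have sizeT : #|T| = size vertices by rewrite -(perm_size f_enum) size_map cardE.
have regG : is_regular G k.
  move=> u; rewrite (eq_card (B := mem [set v | e (f u) (f v)])).
    by rewrite card_preim_count; have /andP[/eqP] := e_srg _ (f_mem u).
  by move=> v; rewrite !inE Ge.
have common u v : u != v ->
    #|common_neighbours G u v| = if G u v then lambda else mu.
  move=> uv; have /andP[_ /allP/(_ _ (f_mem v))] := e_srg _ (f_mem u).
  case/orP=> [/eqP/f_inj uv_eq | /eqP]; first by rewrite uv_eq eqxx in uv.
  rewrite -Ge -card_preim_count => <-.
  by apply: eq_card => t; rewrite !inE !Ge.
have /card_gt0P[u _] : (0 < #|T|)%N by rewrite sizeT (leq_trans _ k_lt).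
split=> //.
- move=> G_complete; have: (#|[set~ u]| <= #|[set v | G u v]|)%N.
    by apply/subset_leq_card/subsetP=> v; rewrite !inE eq_sym; apply: G_complete.
  by rewrite regG cardsC1 sizeT leqNgt -ltnS prednK ?k_lt // (leq_trans _ k_lt).
- move=> G_null; move: k_gt0; rewrite -(regG u) => /card_gt0P[v].
  by rewrite inE (negbTE (G_null u v)).
- move=> u' v uv; rewrite common ?uv //.
  by apply: contraTneq uv => ->; rewrite adj_irr.
by move=> u' v uv nuv; rewrite common // (negbTE nuv).
Qed.

End GraphTransfer.

(** * The explicit graph *)

(** The pair $(a, b)$ stands for $a + b\omega$, so that its second component is
    its trace to $F_2$. *)
Definition K4 := (bool * bool)%type.
Definition add4 (a b : K4) : K4 := (a.1 (+) b.1, a.2 (+) b.2).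
Definition mul4 (a b : K4) : K4 :=
  ((a.1 && b.1) (+) (a.2 && b.2),
   (a.1 && b.2) (+) (a.2 && b.1) (+) (a.2 && b.2)).
Definition cnj4 (a : K4) : K4 := (a.1 (+) a.2, a.2).

Definition K43 := (K4 * K4 * K4)%type.
Definition herm4 (s t : K43) : K4 :=
  add4 (add4 (mul4 s.1.1 (cnj4 t.1.1)) (mul4 s.1.2 (cnj4 t.1.2)))
       (mul4 s.2 (cnj4 t.2)).
Definition prod4 (s : K43) : K4 := mul4 (mul4 s.1.1 s.1.2) s.2.

(** The trace of $p(s) + p(t) + h(s,t)$, where $p$ is the product of the
    coordinates. *)
Definition model_adj (s t : K43) : bool :=
  (prod4 s).2 (+) (prod4 t).2 (+) (herm4 s t).2.

Definition elems4 : seq K4 :=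
  [:: (false, false); (true, false); (false, true); (true, true)].
Definition triples4 : seq K43 :=
  [seq (ab, c) | ab <- [seq (a, b) | a <- elems4, b <- elems4], c <- elems4].
Definition model_vertices : seq K43 :=
  [seq s <- triples4 | herm4 s s == (true, false)].

Lemma model_size : size model_vertices = 36%N.
Proof. by vm_compute. Qed.

Lemma model_srg :
  all (fun s => (count (model_adj s) model_vertices == 14%N) &&
    all (fun t => (s == t) ||
      (count (fun r => model_adj s r && model_adj t r) model_vertices
       == if model_adj s t then 4%N else 6%N)) model_vertices) model_vertices.
Proof. by vm_compute. Qed.

Section Interpretation.
Variables (F : finFieldType) (oF : #|F| = 4%N) (w : F).
Hypothesis hF : [set: F] = [set 0; 1; w; conj4 oF w].

Lemma elems_uniq : uniq [:: 0; 1; w; conj4 oF w].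
Proof.
apply/card_uniqP; rewrite -[RHS]oF -cardsT hF; apply: eq_card => a.
by rewrite !inE !orbA.
Qed.

Lemma conj4_nonfix a : (conj4 oF a != a) = (a == w) || (a == conj4 oF w).
Proof.
have a_in : a \in [:: 0; 1] ++ [:: w; conj4 oF w].
  by have := in_setT a; rewrite hF !inE !orbA.
have : uniq ([:: 0; 1] ++ [:: w; conj4 oF w]) := elems_uniq.
rewrite cat_uniq => /and3P[_ /hasPn disj _].
rewrite conj4_fix -!mem_seq2; move: a_in (disj a); rewrite mem_cat.
by case: (a \in [:: w; _]) => [_ -> | + _]; rewrite ?orbF // => ->.
Qed.

Lemma conj_w : conj4 oF w = 1 + w.
Proof.
have := elems_uniq; rewrite /= !inE !negb_or => /and3P[/and3P[w0 w1 w2] /andP[w3 w4] _].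
have := sum3_root1 oF (_ : w != 1) (_ : w != 0).
by rewrite !(eq_sym w) => /(_ w3 w1)/eqP; rewrite addr_eq0 oppr4 // => /eqP->.
Qed.

Lemma sqr_w : w * w = 1 + w.
Proof. by rewrite -expr2 -[w ^+ 2]/(conj4 oF w) conj_w. Qed.

Definition ev4 (k : K4) : F := k.1%:R + k.2%:R * w.

Lemma natr_addb (b c : bool) : (b (+) c)%:R = b%:R + c%:R :> F.
Proof. by case: b; case: c; rewrite ?addr0 ?add0r ?addrr4. Qed.

Lemma natr_andb (b c : bool) : (b && c)%:R = b%:R * c%:R :> F.
Proof. by rewrite -mulnb natrM. Qed.

Lemma ev4_add j k : ev4 (add4 j k) = ev4 j + ev4 k.
Proof. by rewrite /ev4 /= !natr_addb mulrDl addrACA. Qed.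

Lemma ev4_mul j k : ev4 (mul4 j k) = ev4 j * ev4 k.
Proof.
rewrite /ev4 /= !natr_addb !natr_andb.
move: (j.1%:R) (j.2%:R) (k.1%:R) (k.2%:R) => a b c d.
transitivity (a * c + (a * d + b * c) * w + b * d * (w * w)); last by ring.
by rewrite sqr_w; ring.
Qed.

Lemma ev4_cnj k : ev4 (cnj4 k) = conj4 oF (ev4 k).
Proof.
rewrite /ev4 /= natr_addb rmorphD rmorphM !rmorph_nat /= conj_w.
by rewrite mulrDr mulr1 addrA.
Qed.

(** Conjugation sends $a + b\omega$ to $a + b + b\omega$. *)
Lemma ev4_fix k : (conj4 oF (ev4 k) != ev4 k) = k.2.
Proof.
rewrite -ev4_cnj /ev4 /= natr_addb -subr_eq0.
rewrite (_ : _ - _ = k.2%:R); last by ring.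
by case: (k.2); rewrite ?eqxx // oner_eq0.
Qed.

Lemma ev4_bij : bijective ev4.
Proof.
apply: inj_card_bij; last by rewrite oF card_prod card_bool.
move=> [a b] [c d] e; have bd : b = d.
  by have := congr1 (fun x => conj4 oF x != x) e; rewrite /= !ev4_fix.
move: e; rewrite bd /ev4 /= => /addIr.
by case: a; case: c => // /eqP; rewrite ?[0%:R == _]eq_sym oner_eq0.
Qed.

End Interpretation.

(** * The switched graph of a hyperoval *)

Section SwitchedGraph.
Variables (F : finFieldType) (oF : #|F| = 4%N) (w : F).
Hypothesis hF : [set: F] = [set 0; 1; w; conj4 oF w].
Variables (V : vectType F) (dimV : \dim {:V}%VS = 3%N).
Variables (h : {hermitian V for false & conj4 oF}) (h_nondeg : nondegenerate h).
Variable H : {set {vspace V}}.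
Hypotheses (H_hyperoval : hyperoval H) (H_nonisotropic : H \subset nonisotropic h).
Local Notation W := (vectors_over h H).
Local Notation cG := (compl_graph (switch_graph (Gamma h) W)).

Lemma sform_eq0 u v : (sform h u v == 0) = (conj4 oF (h u v) == h u v).
Proof. by rewrite /sform (hC h v) addrC addr_eq0 oppr4. Qed.

Lemma GammaE (u v : V1 h) :
  Gamma h u v = (u != v) && (conj4 oF (hV1 u v) == hV1 u v).
Proof. by rewrite /= /Gamma_adj /= sform_eq0. Qed.

Lemma hV1_refl (u : V1 h) : hV1 u u = 1.
Proof. exact/eqP/(valP u). Qed.

Lemma mem_vectors_over (u : V1 h) : (u \in W) = (<[val u : V]>%VS \in H).
Proof. by rewrite inE. Qed.

Lemma mem_vectors_overD (u : V1 h) :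
  (u \in vectors_over h (nonisotropic h :\: H)) = (u \notin W).
Proof. by rewrite !inE mem_nonisotropic ?andbT //; apply: hV1_refl. Qed.

(** Orthogonal unit vectors are both on or both off the hyperoval. *)
Lemma hV1_cross_neq0 (u v : V1 h) : (u \in W) != (v \in W) -> hV1 u v != 0.
Proof.
apply: contra => /eqP uv; apply/eqP; apply/idP/idP; rewrite !mem_vectors_over.
  apply: (hyperoval_orthogonal dimV h_nondeg) => //; exact: hV1_refl.
apply: (hyperoval_orthogonal dimV h_nondeg) => //; try exact: hV1_refl.
exact: hC_eq0.
Qed.

Lemma compl_switch_GammaE (u v : V1 h) :
  cG u v = if (u \in W) == (v \in W) then (hV1 u v == w) || (hV1 u v == conj4 oF w)
           else hV1 u v == 1.
Proof.
rewrite compl_switchE GammaE; have [<-|uv] := eqVneq u v.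
  by rewrite eqxx -conj4_nonfix // hV1_refl rmorph1 eqxx.
case: ifP => [_ | /negbT/hV1_cross_neq0 huv].
  by rewrite -conj4_nonfix.
by rewrite conj4_fix (negbTE huv).
Qed.

Lemma edges_compl_switch_Gamma :
  let W' := vectors_over h (nonisotropic h :\: H) in
  edges cG =
       [set [set u; v] | u in W, v in W
          & (hV1 u v == w) || (hV1 u v == conj4 oF w)]
   :|: [set [set u; v] | u in W', v in W'
          & (hV1 u v == w) || (hV1 u v == conj4 oF w)]
   :|: [set [set u; v] | u in W, v in W' & hV1 u v == 1].
Proof.
move=> W'; have W'E u : (u \in W') = (u \notin W) := mem_vectors_overD u.
apply/setP=> e; rewrite !in_setU; apply/imset2P/idP.
  case=> u v _; rewrite inE compl_switch_GammaE => /andP[_ +] ->.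
  case: eqP => [uvW huv | ].
    have [uW|uW] := boolP (u \in W).
      by apply/orP; left; apply/orP; left; apply/imset2P; exists u v; rewrite // inE -uvW uW.
    by apply/orP; left; apply/orP; right; apply/imset2P;
      exists u v; rewrite ?W'E // inE W'E -uvW uW.
  case uW: (u \in W); case vW: (v \in W) => // _ huv; apply/orP; right.
    by apply/imset2P; exists u v; rewrite // inE W'E vW.
  rewrite setUC; apply/imset2P; exists v u; rewrite // inE W'E uW /=.
  by rewrite /hV1 hC -/(hV1 u v) (eqP huv) rmorph1.
case/orP=> [/orP[]|] /imset2P[u v uW]; rewrite inE => /andP[vW huv] ->;
  exists u v; rewrite // inE compl_switch_GammaE.
- by rewrite uW vW.
- by move: uW vW; rewrite !W'E => /negbTE-> /negbTE->.
by move: vW; rewrite W'E uW => /negbTE->.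
Qed.

(** Coordinates in an adapted frame give an isomorphism to the model graph. *)
Lemma strongly_regular_compl_switch_Gamma : strongly_regular cG 36 14 4 6.
Proof.
have [x [y [z [fr H_fr]]]] := adapted_frame_exists dimV h_nondeg H_hyperoval H_nonisotropic.
have [dec evK decK] := ev4_bij hF.
pose code (u : V1 h) : K43 :=
  (dec (h (val u) x), dec (h (val u) y), dec (h (val u) z)).
have code_herm u v : ev4 w (herm4 (code u) (code v)) = hV1 u v.
  by rewrite /herm4 !(ev4_add oF) !(ev4_mul hF) !(ev4_cnj hF) !decK -frame_form.
have code_prod u : ev4 w (prod4 (code u)) = coord_prod h x y z (val u).
  by rewrite /prod4 !(ev4_mul hF) !decK.
have code_inj : injective code.
  move=> u v [/(can_inj decK) ux /(can_inj decK) uy /(can_inj decK) uz].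
  apply: val_inj; rewrite /= (frame_expand dimV (val u) fr) ux uy uz.
  by rewrite -(frame_expand dimV (val v) fr).
have code_adj u v : cG u v = model_adj (code u) (code v).
  have memW t : (t \in W) = ~~ (prod4 (code t)).2.
    rewrite -(ev4_fix hF) negbK code_prod mem_vectors_over.
    by apply: (mem_hyperoval dimV h_nondeg) => //; apply: hV1_refl.
  rewrite compl_switchE GammaE !memW -code_herm.
  rewrite /model_adj -[(herm4 _ _).2](ev4_fix hF).
  have [<-|_] := eqVneq u v; first by rewrite addbb code_herm hV1_refl rmorph1 !eqxx.
  by case: (_ == ev4 _ _); case: (prod4 (code u)).2; case: (prod4 (code v)).2.
have code_enum : perm_eq (map code (enum (V1 h))) model_vertices.
  apply: uniq_perm => [||s]; first by rewrite map_inj_uniq ?enum_uniq.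
    by vm_compute.
  have ev_one : ev4 w (true, false) = 1 by rewrite /ev4 /= mul0r addr0.
  rewrite mem_filter (_ : s \in triples4) ?andbT; last first.
    by case: s => [[[[] []] [[] []]] [[] []]].
  apply/mapP/eqP=> [[u _ ->] | s1].
    by apply: (can_inj evK); rewrite code_herm hV1_refl.
  pose v := ev4 w s.1.1 *: x + ev4 w s.1.2 *: y + ev4 w s.2 *: z.
  have [[x1 y1 z1] [xy xz yz]] := fr.
  have vE : (h v x = ev4 w s.1.1) * (h v y = ev4 w s.1.2) * (h v z = ev4 w s.2).
    rewrite !hDl !hZl x1 y1 z1 xy xz yz (hC_eq0 xy) (hC_eq0 xz) (hC_eq0 yz).
    by rewrite !mulr0 !mulr1 !addr0 !add0r.
  have v1 : h v v == 1.
    rewrite (frame_form dimV v v fr) !vE -!(ev4_cnj hF) -!(ev4_mul hF) -!(ev4_add oF).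
    by rewrite -ev_one -s1.
  exists (Sub (v : finvect_type V) v1); first by rewrite mem_enum.
  by rewrite /code SubK !vE !evK; case: s {s1 v vE v1} => [[]].
rewrite -model_size.
by apply: (strongly_regular_model code_inj code_enum code_adj _ _ model_srg).
Qed.

End SwitchedGraph.

Theorem theorem4p5 (F : finFieldType) (oF : #|F| = 4%N) (w : F)
    (hF : [set: F] = [set 0; 1; w; conj4 oF w])
    (V : vectType F) (dimV : \dim {:V}%VS = 3%N)
    (h : {hermitian V for false & conj4 oF}) (h_nondeg : nondegenerate h)
    (H0 : {set {vspace V}}) (H0_hyperoval : hyperoval H0)
    (H0_nonisotropic : H0 \subset nonisotropic h) :
  let H0' := nonisotropic h :\: H0 in
  let W := vectors_over h H0 in
  let W' := vectors_over h H0' in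
  let Gamma' := switch_graph (Gamma h) W in
  strongly_regular (compl_graph Gamma') 36 14 4 6
  /\ edges (compl_graph Gamma') =
       [set [set u; v] | u in W, v in W
          & (hV1 u v == w) || (hV1 u v == conj4 oF w)]
   :|: [set [set u; v] | u in W', v in W'
          & (hV1 u v == w) || (hV1 u v == conj4 oF w)]
   :|: [set [set u; v] | u in W, v in W' & hV1 u v == 1].
Proof.
split; first exact: (strongly_regular_compl_switch_Gamma hF dimV h_nondeg).
exact: (edges_compl_switch_Gamma hF dimV h_nondeg).
Qed.
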